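(* Let $\lambda$ and $\mu$ be partitions. The toggle map $\nu\mapsto(T(\nu),n)$ relative to $\lambda$ and $\mu$ is a bijection from the set of partitions $\nu$ with $\mu\prec\nu\succ\lambda$ to the set of pairs $(\nu',n)$ consisting of a partition $\nu'$ with $\mu\succ\nu'\prec\lambda$ and an integer $n\ge0$. Moreover, it preserves weight in the following manner: for every such $\nu$, with $n$ the entry popped off in the toggle, $$|\nu|-|\lambda| = |\mu|-|T(\nu)|+n \quad\text{and}\quad |\nu|-|\mu| = |\lambda|-|T(\nu)|+n.$$
   Context: A partition is a weakly decreasing sequence $\lambda=(\lambda_1,\lambda_2,\dots)$ of nonnegative integers with finitely many nonzero terms; $|\lambda|=\sum_i\lambda_i$. We write $\lambda\succ\mu$ (equivalently $\mu\prec\lambda$) if $\lambda_1\ge\mu_1\ge\lambda_2\ge\mu_2\ge\cdots$. Toggle: for partitions with $\lambda\prec\nu\succ\mu$, the toggle of $\nu$ relative to $\lambda$ and $\mu$ is the pair $(T(\nu),n)$, where $$T(\nu)_i=\min\{\lambda_i,\mu_i\}+\max\{\lambda_{i+1},\mu_{i+1}\}-\nu_{i+1}\qquad(i\ge1),$$ and $n=\nu_1-\max\{\lambda_1,\mu_1\}$ is the value popped off. *)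

(* Defs.v *)
From mathcomp Require Import all_boot all_order all_algebra.
From mathcomp Require Import boolp classical_sets functions cardinality fsbigop.

Set Implicit Arguments.
Unset Strict Implicit.
Unset Printing Implicit Defensive.

Import Order.TTheory GRing.Theory Num.Theory.
Local Open Scope classical_set_scope.
Local Open Scope ring_scope.

(* Sequences are indexed from 0, so that the part lambda_i is [lambda (i - 1)].
   Values are taken in [int] so that the subtractions in the toggle and in the
   weight identities are the usual ones; nonnegativity of the parts is imposed
   explicitly. *)
Definition is_intpart (la : nat -> int) : Prop :=
  [/\ forall i, 0 <= la i,
      forall i, la i.+1 <= la i &
      finite_set [set i | la i != 0]].

(* This is |la| when [la] has finite support; [\sum_(i \in _)] is 0 otherwise. *)
Definition weight (la : nat -> int) : int := \sum_(i \in [set: nat]) la i.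

(* [interlaces la mu] is lambda >- mu:
   lambda_1 >= mu_1 >= lambda_2 >= mu_2 >= ... *)
Definition interlaces (la mu : nat -> int) : Prop :=
  forall i, mu i <= la i /\ la i.+1 <= mu i.

Definition toggle (la mu nu : nat -> int) : nat -> int :=
  fun i => Num.min (la i) (mu i) + Num.max (la i.+1) (mu i.+1) - nu i.+1.

Definition popped (la mu nu : nat -> int) : int :=
  nu 0%N - Num.max (la 0%N) (mu 0%N).

Definition toggle_map (la mu nu : nat -> int) : (nat -> int) * int :=
  (toggle la mu nu, popped la mu nu).

Definition toggle_dom (la mu : nat -> int) : set (nat -> int) :=
  [set nu | [/\ is_intpart nu, interlaces nu mu & interlaces nu la]].

Definition toggle_codom (la mu : nat -> int) : set ((nat -> int) * int) :=
  [set p | [/\ is_intpart p.1, interlaces mu p.1, interlaces la p.1 &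
               0 <= p.2]].

(* Main.v *)
Require Import Defs.
From mathcomp Require Import all_boot all_order all_algebra.
From mathcomp Require Import boolp classical_sets functions cardinality fsbigop.
From mathcomp Require Import zify ring.
Local Open Scope classical_set_scope.
Local Open Scope ring_scope.

(** Since [la] and [mu] both interlace below [nu], the entry [nu_(i+1)] lies in
    the interval from [max (la_(i+1), mu_(i+1))] to [min (la_i, mu_i)], and
    toggling reflects it in the midpoint of this interval; the first entry is
    instead recorded by the popped value. Reflections being involutive, the map
    is bijective. The weight identities follow by summation from
    [min (a, b) + max (a, b) = a + b]. *)

(** Replaces finite support by an explicit cutoff, so that weights become ordinary sums over an
    initial segment. *)
Lemma finite_support_eventually0 (f : nat -> int) :
  finite_set [set i | f i != 0] <->
  exists N, forall i, (N <= i)%N -> f i = 0.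
Proof.
split=> [/finite_fsetP[X fX]|[N fN]].
  (* Taking successors puts the cutoff strictly beyond every index of the support. *)
  exists (\max_(i <- finmap.enum_fset X) i.+1)%N => i leNi.
  apply/eqP/negPn/negP => fi.
  have : [set j | f j != 0] i by [].
  rewrite fX /= => iX.
  have : (i.+1 <= \max_(j <- finmap.enum_fset X) j.+1)%N by apply: leq_bigmax_seq.
  by lia.
apply: (@sub_finite_set _ _ `I_N); last exact: finite_II.
move=> i /= /eqP fi; rewrite ltnNge; apply/negP => /fN.
exact: fi.
Qed.

Lemma weight_sum (f : nat -> int) (N : nat) :
  (forall i, (N <= i)%N -> f i = 0) -> weight f = \sum_(i < N) f i.
Proof.
move=> fN; rewrite /weight -(@fsbig_widen _ _ _ _ `I_N setT) //.
  by rewrite fsbig_ord.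
move=> i /= [_ /negP]; rewrite -leqNgt; exact: fN.
Qed.

Lemma interlaces_intpart_below (la nu : nat -> int) :
  is_intpart la -> interlaces la nu -> is_intpart nu.
Proof.
move=> [la0 _ /finite_support_eventually0[N laN]] lanu; split.
- by move=> i; have [_ ?] := lanu i; have := la0 i.+1; lia.
- by move=> i; have [_ ?] := lanu i; have [? _] := lanu i.+1; lia.
- apply/finite_support_eventually0; exists N => i Ni.
  by have [] := lanu i; rewrite (laN _ Ni) (laN i.+1) ?leqW//; lia.
Qed.

Lemma interlaces_intpart_above (la nu : nat -> int) :
  is_intpart la -> interlaces nu la -> is_intpart nu.
Proof.
move=> [la0 _ /finite_support_eventually0[N laN]] nula; split.
- by move=> i; have [? _] := nula i; have := la0 i; lia.
- by move=> i; have [? ?] := nula i; lia.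
(* The support may grow by one index: [nu i.+1] is bounded above only by [la i]. *)
- apply/finite_support_eventually0; exists N.+1 => -[//|i] Ni.
  have [_] := nula i; have [] := nula i.+1.
  by rewrite (laN i) ?(laN i.+1) ?leqW//; lia.
Qed.

Lemma toggle_interlaces (la mu nu : nat -> int) :
  interlaces nu la -> interlaces nu mu -> interlaces la (toggle la mu nu).
Proof.
move=> nula numu i; rewrite /toggle.
have [_ ?] := nula i; have [? _] := nula i.+1.
have [_ ?] := numu i; have [? _] := numu i.+1.
by lia.
Qed.

Lemma toggleC (la mu nu : nat -> int) : toggle la mu nu = toggle mu la nu.
Proof. by apply/funext => i; rewrite /toggle; lia. Qed.

(** The inverse of [toggle_map]: entry [j.+1] reflects [nu j] back in the same interval, and entry 0
    is recovered from the popped value [n]. *)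
Definition untoggle (la mu nu : nat -> int) (n : int) (i : nat) : int :=
  if i is j.+1 then
    Num.min (la j) (mu j) + Num.max (la j.+1) (mu j.+1) - nu j
  else n + Num.max (la 0%N) (mu 0%N).

Lemma untoggle_interlaces (la mu nu : nat -> int) (n : int) :
  0 <= n -> interlaces la nu -> interlaces mu nu ->
  interlaces (untoggle la mu nu n) la.
Proof.
move=> n0 lanu munu i; have := lanu i; have := munu i.
case: i => [|i] /=; first by lia.
by have := lanu i; have := munu i; lia.
Qed.

Lemma untoggleC (la mu nu : nat -> int) (n : int) :
  untoggle la mu nu n = untoggle mu la nu n.
Proof. by apply/funext => -[|i] /=; lia. Qed.

Lemma toggle_mapK (la mu nu : nat -> int) :
  untoggle la mu (toggle la mu nu) (popped la mu nu) = nu.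
Proof. by apply/funext => -[|i]; rewrite /= /popped /toggle; lia. Qed.

Lemma untoggleK (la mu nu : nat -> int) (n : int) :
  toggle_map la mu (untoggle la mu nu n) = (nu, n).
Proof.
rewrite /toggle_map /popped /=; congr pair; last by lia.
by apply/funext => i; rewrite /toggle /=; lia.
Qed.

(** Symmetric form, without subtraction, from which both weight identities follow by
    rearrangement. *)
Lemma weight_toggle (la mu nu : nat -> int) :
  is_intpart la -> is_intpart mu -> is_intpart nu ->
  is_intpart (toggle la mu nu) ->
  weight nu + weight (toggle la mu nu) =
    weight la + weight mu + popped la mu nu.
Proof.
move=> [_ _ /finite_support_eventually0[N1 la0]].
move=> [_ _ /finite_support_eventually0[N2 mu0]].
move=> [_ _ /finite_support_eventually0[N3 nu0]].
move=> [_ _ /finite_support_eventually0[N4 t0]].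
pose N := (N1 + N2 + N3 + N4)%N.
rewrite !(@weight_sum _ N); do ?by move=> i Ni;
  rewrite ?la0 ?mu0 ?nu0 ?t0 //; move: Ni; rewrite /N; lia.
(* Truncating at [M] leaves the boundary term [max (la M, mu M) - nu M], since [toggle] involves
   entries of index [M], one past the last summand. *)
have partial_sums M : \sum_(i < M) nu i + \sum_(i < M) toggle la mu nu i =
    \sum_(i < M) la i + \sum_(i < M) mu i + popped la mu nu
    + Num.max (la M) (mu M) - nu M.
  elim: M => [|M IH]; first by rewrite !big_ord0 /popped; lia.
  rewrite !big_ord_recr /=.
  (* Trading the minimum for a maximum makes the boundary terms telescope. *)
  have -> : toggle la mu nu M = la M + mu M - Num.max (la M) (mu M)
      + Num.max (la M.+1) (mu M.+1) - nu M.+1 by rewrite /toggle; lia.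
  by rewrite GRing.addrACA IH; ring.
(* At [N], beyond all the supports, the boundary term vanishes. *)
rewrite partial_sums la0 ?mu0 ?nu0; rewrite /N; lia.
Qed.

Theorem proposition3p4 (la mu : nat -> int)
    (hla : is_intpart la) (hmu : is_intpart mu) :
  set_bij (toggle_dom la mu) (toggle_codom la mu) (toggle_map la mu) /\
  (forall nu : nat -> int, toggle_dom la mu nu ->
     weight nu - weight la
       = weight mu - weight (toggle la mu nu) + popped la mu nu /\
     weight nu - weight mu
       = weight la - weight (toggle la mu nu) + popped la mu nu).
Proof.
have toggle_part nu : toggle_dom la mu nu -> is_intpart (toggle la mu nu).
  move=> [_ numu nula].
  exact: (interlaces_intpart_below _ _ hla (toggle_interlaces _ _ _ nula numu)).
split; last first.
  move=> nu dom_nu; have [hnu _ _] := dom_nu.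
  by have := weight_toggle _ _ _ hla hmu hnu (toggle_part _ dom_nu); lia.
split.
- move=> nu dom_nu; have [_ numu nula] := dom_nu; split=> /=.
  + exact: toggle_part.
  + by rewrite toggleC; exact: toggle_interlaces.
  + exact: toggle_interlaces.
  + by rewrite /popped; have [? _] := numu 0%N; have [? _] := nula 0%N; lia.
- move=> nu nu' _ _ [eqT eqn].
  by rewrite -(toggle_mapK la mu nu) eqT eqn toggle_mapK.
- move=> [nu n] [_ /= munu lanu n0].
  (* Surjectivity: interlacing above the partition [la] also makes the preimage a partition. *)
  have above_la := untoggle_interlaces _ _ _ _ n0 lanu munu.
  exists (untoggle la mu nu n); last exact: untoggleK.
  split=> //; first exact: (interlaces_intpart_above _ _ hla above_la).
  by rewrite untoggleC; exact: untoggle_interlaces.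
Qed.
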